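(* Let $\mathbb{K}\in\{\mathbb{R},\mathbb{C}\}$ and let $f\in\mathbb{K}[x_1,\dots,x_n]$ be a homogeneous polynomial of degree $3$ such that the subspace $\mathcal{V}$ spanned by its $n$ slices is non-singular and does not satisfy the Commutativity Property. Let $h(x)=f(Rx)$, where the entries $r_{ij}$ of $R$ are chosen uniformly and independently at random from a finite set $S\subset\mathbb{K}$, and let $T_1,\dots,T_n$ be the slices of $h$; if $T_1$ is invertible let $T_1'=T_1^{-1}$. Then $\Pr[T_1\text{ is invertible and }T_1'T_2,\ T_1'T_3\text{ commute}]\le\frac{2}{|S|}$.
   Context: The slices of a cubic form $g=\sum_{i,j,k}T_{ijk}x_ix_jx_k$ with $(T_{ijk})$ symmetric are the matrices $T_k=(T_{ijk})_{1\le i,j\le n}$, $k\in[n]$. A subspace of matrices is non-singular if it contains an invertible matrix. A non-singular subspace $\mathcal{V}$ satisfies the Commutativity Property if there exists an invertible $A\in\mathcal{V}$ such that $A^{-1}\mathcal{V}$ is a commuting subspace. *)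

(* Defs.v *)
From HB Require Import structures.
From mathcomp Require Import all_boot all_order all_algebra.
From mathcomp Require Import finmap mpoly complex reals.
From mathcomp Require Import ring.

Set Implicit Arguments.
Unset Strict Implicit.
Unset Printing Implicit Defensive.

Import GRing.Theory.
Local Open Scope ring_scope.

Definition tensor (K : fieldType) (n : nat) := 'I_n -> 'I_n -> 'I_n -> K.

(* The two transpositions generate all permutations of the three indices. *)
Definition symmetric_tensor (K : fieldType) (n : nat) (T : tensor K n) : Prop :=
  forall i j k, T i j k = T j i k /\ T i j k = T i k j.

Definition tensor_form (K : fieldType) (n : nat) (T : tensor K n) :
    {mpoly K[n]} :=
  \sum_(i < n) \sum_(j < n) \sum_(k < n) T i j k *: ('X_i * 'X_j * 'X_k).

(* In characteristic 0 each cubic form has exactly one such tensor: see       *)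
(* tensor_of_exists and tensor_of_unique below.                               *)
Definition tensor_of (K : fieldType) (n : nat) (g : {mpoly K[n]})
    (T : tensor K n) : Prop :=
  symmetric_tensor T /\ g = tensor_form T.

Definition slice (K : fieldType) (n : nat) (T : tensor K n) (k : 'I_n) :
    'M[K]_n :=
  \matrix_(i, j) T i j k.

Definition slice_space (K : fieldType) (n : nat) (T : tensor K n) :
    {vspace 'M[K]_n} :=
  <<[tuple slice T k | k < n]>>%VS.

Definition nonsingular_space (K : fieldType) (n : nat)
    (V : {vspace 'M[K]_n}) : Prop :=
  exists2 A : 'M[K]_n, A \in V & A \in unitmx.

Definition commuting_space (K : fieldType) (n : nat)
    (V : {vspace 'M[K]_n}) : Prop :=
  forall B C : 'M[K]_n, B \in V -> C \in V -> comm_mx B C.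

Definition lmul_space (K : fieldType) (n : nat) (A : 'M[K]_n)
    (V : {vspace 'M[K]_n}) : {vspace 'M[K]_n} :=
  (linfun (mulmx A) @: V)%VS.

Definition commutativity_property (K : fieldType) (n : nat)
    (V : {vspace 'M[K]_n}) : Prop :=
  exists A : 'M[K]_n,
    [/\ A \in V, A \in unitmx & commuting_space (lmul_space (invmx A) V)].

(* f(Mx): the variable x_i is replaced by the i-th coordinate of Mx. *)
Definition lin_subst (K : fieldType) (n : nat) (f : {mpoly K[n]})
    (M : 'M[K]_n) : {mpoly K[n]} :=
  f \mPo [tuple \sum_(j < n) M i j *: 'X_j | i < n].

(* Probability of E under the product over all entries (i, j) of the uniform  *)
(* distributions on S; S is coerced to the finite type of its elements.       *)
Definition prob_unif_mx (R : realType) (K : fieldType) (S : {fset K})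
    (n : nat) (E : pred 'M[K]_n) : R :=
  \sum_(M : 'M[S]_n | E (map_mx val M))
    \prod_(i < n) \prod_(j < n) (#|` S|%:R)^-1.

Lemma euler_homog (K : fieldType) (n d : nat) (f : {mpoly K[n]}) :
  f \is d.-homog -> \sum_(i < n) 'X_i * f^`M(i) = f *+ d.
Proof.
move=> fh; rewrite [in RHS](mpolyE f) -sumrMnl.
under eq_bigr => i _ do rewrite {1}(mpolyE f) linear_sum mulr_sumr.
rewrite exchange_big /= big_seq [RHS]big_seq; apply: eq_bigr => m mf.
under eq_bigr => i _.
  rewrite mderivZ mderivX -!scalerAr.
  have -> : (m i)%:R *: ('X_i * 'X_[m - U_(i)]) = 'X_[m] *+ m i :> {mpoly K[n]}.
    case: (posnP (m i)) => [->|mi0]; first by rewrite scale0r mulr0n.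
    rewrite -mpolyXD addmC submK ?scaler_nat //.
    by apply/mnm_lepP => j; rewrite mnm1E; case: eqP => // <-.
  over.
by rewrite -scaler_sumr sumrMnr -mdegE (dhomog_mf fh mf) scalerMnr.
Qed.

Lemma mderiv_homog (K : fieldType) (n d : nat) (f : {mpoly K[n]}) (i : 'I_n) :
  f \is d.+1.-homog -> f^`M(i) \is d.-homog.
Proof.
move=> fh; apply/dhomogP => m; rewrite mcoeff_msupp mcoeff_mderiv => mf.
have : f@_(m + U_(i)) != 0 by apply: contra mf => /eqP->; rewrite mul0rn.
by rewrite -mcoeff_msupp => /(dhomog_mf fh); rewrite /= mdegD mdeg1 addn1 => -[].
Qed.

Lemma tensor_of_exists (K : fieldType) (n : nat) (f : {mpoly K[n]}) :
  6%:R != 0 :> K -> f \is 3.-homog -> exists T, tensor_of f T.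
Proof.
move=> K6 fh; exists (fun i j k => 6%:R^-1 * f^`M(i)^`M(j)^`M(k)@_0).
split=> [i j k|].
  by split; [rewrite (mderiv_comm i j) | rewrite (mderiv_comm j k)].
have c3 i j k : f^`M(i)^`M(j)^`M(k) = (f^`M(i)^`M(j)^`M(k)@_0)%:MP.
  have /dhomogP h0 : f^`M(i)^`M(j)^`M(k) \is 0.-homog by do 3!apply: mderiv_homog.
  apply/mpolyP => m; rewrite mcoeffC; case: eqP => [<-|/eqP m0]; rewrite ?mulr1 //.
  rewrite mulr0; apply: memN_msupp_eq0; apply: contra m0 => /h0 /eqP /=.
  by rewrite mdeg_eq0 eq_sym.
have fE : f *+ 6 = \sum_(i < n) \sum_(j < n) \sum_(k < n)
    (f^`M(i)^`M(j)^`M(k)@_0) *: ('X_i * 'X_j * 'X_k).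
  rewrite (_ : 6 = 3 * 2)%N // mulrnA -(euler_homog fh) -sumrMnl.
  apply: eq_bigr => i _; have fi := mderiv_homog i fh.
  rewrite -mulrnAr -(euler_homog fi) mulr_sumr; apply: eq_bigr => j _.
  have fij := mderiv_homog j fi.
  rewrite -[in LHS](mulr1n (f^`M(i)^`M(j))) -(euler_homog fij) !mulr_sumr.
  by apply: eq_bigr => k _; rewrite {1}c3 -mul_mpolyC !mulrA mulrC !mulrA.
rewrite -[LHS](scalerK K6) scaler_nat fE /tensor_form scaler_sumr.
apply: eq_bigr => i _; rewrite scaler_sumr; apply: eq_bigr => j _.
by rewrite scaler_sumr; apply: eq_bigr => k _; rewrite scalerA.
Qed.

Lemma tensor_form_deriv (K : fieldType) (n : nat) (T : tensor K n) a b c :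
  symmetric_tensor T ->
  (tensor_form T)^`M(a)^`M(b)^`M(c) = (T a b c *+ 6)%:MP.
Proof.
move=> sT.
have dX i j : ('X_i : {mpoly K[n]})^`M(j) = (i == j)%:R.
  rewrite mderivX mnm1E; case: eqP => [->|_]; last by rewrite scale0r.
  rewrite scale1r (_ : (_ - _)%MM = 0%MM) ?mpolyX0 //.
  by apply/mnmP => l; rewrite !mnmE subnn.
have pick (F : 'I_n -> {mpoly K[n]}) (x : 'I_n) :
    \sum_(i < n) (i == x)%:R * F i = F x.
  rewrite (bigD1 x) //= eqxx mul1r big1 ?addr0 // => i /negbTE->.
  by rewrite mul0r.
have d1 : (tensor_form T)^`M(a) =
    (\sum_(j < n) \sum_(k < n) T a j k *: ('X_j * 'X_k)) *+ 3.
  transitivity (\sum_(i < n) \sum_(j < n) \sum_(k < n)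
     ((i == a)%:R * (T i j k *: ('X_j * 'X_k)) +
      (j == a)%:R * (T i j k *: ('X_i * 'X_k)) +
      (k == a)%:R * (T i j k *: ('X_i * 'X_j)))).
    rewrite linear_sum; apply: eq_bigr => i _.
    rewrite linear_sum; apply: eq_bigr => j _.
    rewrite linear_sum; apply: eq_bigr => k _.
    rewrite linearZ /= !mderivM !dX -!mul_mpolyC; ring.
  do 3!under eq_bigr => i _ do under eq_bigr => j _ do rewrite ?big_split /=.
  under eq_bigr => i _ do rewrite !big_split /=.
  rewrite !big_split /= !mulrS mulr0n addr0 -addrA; congr (_ + (_ + _)).
  - under eq_bigr => i _ do under eq_bigr => j _ do rewrite -mulr_sumr.
    under eq_bigr => i _ do rewrite -mulr_sumr.
    by rewrite pick.
  - apply: eq_bigr => i _.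
    under eq_bigr => j _ do rewrite -mulr_sumr.
    by rewrite pick; apply: eq_bigr => k _; rewrite (sT i a k).1.
  - apply: eq_bigr => i _; apply: eq_bigr => j _.
    by rewrite pick (sT i j a).2 (sT i a j).1.
have d2 : (\sum_(j < n) \sum_(k < n) T a j k *: ('X_j * 'X_k))^`M(b) =
    (\sum_(k < n) T a b k *: 'X_k) *+ 2.
  transitivity (\sum_(j < n) \sum_(k < n)
     ((j == b)%:R * (T a j k *: 'X_k) + (k == b)%:R * (T a j k *: 'X_j))
     : {mpoly K[n]}).
    rewrite linear_sum; apply: eq_bigr => j _.
    rewrite linear_sum; apply: eq_bigr => k _.
    rewrite linearZ /= !mderivM !dX -!mul_mpolyC; ring.
  under eq_bigr => j _ do rewrite big_split /= pick -mulr_sumr.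
  rewrite big_split /= pick mulr2n; congr (_ + _).
  by apply: eq_bigr => k _; rewrite (sT a k b).2.
have d3 : (\sum_(k < n) T a b k *: 'X_k)^`M(c) = (T a b c)%:MP.
  rewrite linear_sum -(pick (fun k => (T a b k)%:MP)); apply: eq_bigr => k _.
  by rewrite linearZ /= dX -mul_mpolyC mulrC.
by rewrite d1 mderivMn d2 !mderivMn d3 -!mulrnA -mpolyCMn.
Qed.

Lemma tensor_of_unique (K : fieldType) (n : nat) (f : {mpoly K[n]})
    (T1 T2 : tensor K n) :
  6%:R != 0 :> K -> tensor_of f T1 -> tensor_of f T2 ->
  forall i j k, T1 i j k = T2 i j k.
Proof.
move=> K6 [s1 f1] [s2 f2] i j k; apply: (mulfI K6); rewrite !mulr_natl.
have : (T1 i j k *+ 6)%:MP = (T2 i j k *+ 6)%:MP :> {mpoly K[n]}.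
  by rewrite -!tensor_form_deriv // -f1 f2.
by move=> /(congr1 (mcoeff 0%MM)); rewrite !mcoeffC eqxx !mulr1.
Qed.

Lemma lin_subst_homog (K : fieldType) (n d : nat) (f : {mpoly K[n]})
    (M : 'M[K]_n) :
  f \is d.-homog -> lin_subst f M \is d.-homog.
Proof.
move=> fh; rewrite /lin_subst comp_mpolyE big_seq rpred_sum // => m mf.
rewrite dhomogZ // -(dhomog_mf fh mf) /= mdegE.
elim/big_rec2: _ => [|i p q _ ph]; first exact: dhomog1.
rewrite dhomogM // tnth_mktuple -[X in X.-homog]mul1n; apply: dhomogMn.
by apply: rpred_sum => j _; apply: dhomogZ; rewrite dhomogX /= mdeg1.
Qed.

(* So the second and third slices always exist. *)
Lemma noncommutative_gt2 (K : fieldType) (n : nat) (T : tensor K n) :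
  nonsingular_space (slice_space T) ->
  ~ commutativity_property (slice_space T) -> (2 < n)%N.
Proof.
move=> [A AV Au] nc; rewrite ltnNge; apply/negP => n2; apply: nc.
exists A; split=> //; set V := slice_space T in AV *.
have [w Vw] : exists w, V = (<[A]> + <[w]>)%VS.
  have [A0|A0] := eqVneq A 0.
    have n0 : n = 0%N by apply/eqP; move: Au; rewrite A0 unitmxE; case: (n) => // m;
      rewrite det0 unitr0.
    exists 0; apply/eqP; rewrite A0 addv0 eqEsubv sub0v andbT.
    by apply/subvP => B _; rewrite memv0; subst n; rewrite (flatmx0 B).
  have sAV : (<[A]> <= V)%VS by rewrite -memvE.
  have dW : (\dim (V :\: <[A]>) <= 1)%N.
    have := dimv_cap_compl V <[A]>; rewrite (capv_idPr sAV) dim_vline A0 /= add1n.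
    have : (\dim V <= 2)%N by apply: leq_trans (dim_span _) _; rewrite size_tuple.
    by move=> + dV; rewrite -dV.
  exists (vpick (V :\: <[A]>)); rewrite -{1}(addv_diff_cap V <[A]>) (capv_idPr sAV) addvC.
  congr (_ + _)%VS; apply/esym/eqP; rewrite eqEdim -memvE memv_pick /= dim_vline vpick0.
  by case: eqP => [->|]; rewrite ?dimv0.
suff X B : B \in lmul_space (invmx A) V ->
    exists a b, B = a%:M + b *: (invmx A *m w).
  move=> _ _ /X[a [b ->]] /X[c [d ->]]; rewrite /comm_mx !mulmxDl !mulmxDr.
  rewrite -!scalar_mxM !mul_mx_scalar !mul_scalar_mx -!scalemxAl -!scalemxAr.
  rewrite !scalerA (mulrC a) (mulrC b) addrACA addrA -!addrA.
  by congr (_ + _); rewrite addrCA.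
move=> /memv_imgP[C]; rewrite Vw => /memv_addP[_ /vlineP[a ->] [_ /vlineP[b ->] ->]] ->.
exists a, b; rewrite lfunE /= mulmxDr -!scalemxAr mulVmx //; congr (_ + _).
by rewrite scalemx1.
Qed.

(* Main.v *)
Require Import Defs.
From HB Require Import structures.
From mathcomp Require Import all_boot all_order all_algebra.
From mathcomp Require Import finmap mpoly complex reals.

(* The slices of f(Mx) are M^T A_c M, where A_c is the combination of the slices
   of f with coefficients the c-th column of M. So the event forces A_1 to be
   invertible and A_1^-1 A_2, A_1^-1 A_3 to commute. Fix the first column with
   A_1 invertible. By hypothesis there are slices T_k, T_l of f for which
   A_1^-1 T_k and A_1^-1 T_l do not commute. If A_1^-1 A_2 commutes with
   A_1^-1 T_l, then the entry (k, 2) of M is determined by the other entries;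
   otherwise the entry (l, 3) is. Each case has probability at most 1/|S|. *)

Import GRing.Theory Num.Theory.
Local Open Scope ring_scope.

(** * Counting matrices with one determined entry *)

Definition set_entry {A : Type} {m n : nat} (M : 'M[A]_(m, n))
    (p : 'I_m * 'I_n) (s : A) : 'M[A]_(m, n) :=
  \matrix_(i, j) if (i, j) == p then s else M i j.

(* The position may depend on the matrix, provided that it ignores the entry
   it points to: (M, s) |-> (M with entry p M set to s, old entry) is then an
   involution. *)
Lemma card_determined_entry (A : finType) (m n : nat) (P : pred 'M[A]_(m, n))
    (p : 'M[A]_(m, n) -> 'I_m * 'I_n) :
  (forall M s, p (set_entry M (p M) s) = p M) ->
  (forall M s t, P (set_entry M (p M) s) -> P (set_entry M (p M) t) -> s = t) ->
  (#|P| * #|A| <= #|{: 'M[A]_(m, n)}|)%N.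
Proof.
move=> pE Puniq.
pose swap (x : 'M[A]_(m, n) * A) :=
  (set_entry x.1 (p x.1) x.2, x.1 (p x.1).1 (p x.1).2).
have swapK : involutive swap.
  case=> M s; rewrite /swap /= pE; congr pair.
    apply/matrixP => i j; rewrite !mxE; case: eqP => //.
    by case: (p M) => a b [-> ->].
  by rewrite !mxE -surjective_pairing eqxx.
have -> : (#|P| * #|A| = \sum_(x : 'M[A]_(m, n) * A) P x.1)%N.
  rewrite -(pair_bigA _ (fun M (s : A) => P M : nat)) /=.
  rewrite -(sum1_card P) big_distrl big_mkcond /=; apply: eq_bigr => M _.
  by rewrite sum_nat_const unfold_in; case: (P M); rewrite ?mul1n ?muln1 ?muln0.
(* The pairs [(M, s)] with [P M] are reindexed along [swap]: now, for each [M], only the values [s]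
   for which [set_entry M (p M) s] satisfies [P] count, and there is at most one. *)
rewrite (reindex_inj (inv_inj swapK)) /=.
rewrite -(pair_bigA _ (fun M s => P (set_entry M (p M) s) : nat)) /=.
rewrite -sum1_card; apply: leq_sum => M _.
rewrite -big_mkcond sum1_card /=; apply/card_le1P => s Ps t.
by rewrite inE; apply/idP/eqP => [Pt|->//]; apply: Puniq Pt Ps.
Qed.

Lemma comm_mx_scale (K : fieldType) (n : nat) (a : K) (X Y : 'M[K]_n) :
  comm_mx X Y -> comm_mx X (a *: Y).
Proof. by rewrite /comm_mx -scalemxAr -scalemxAl => ->. Qed.

(** Subtracting the two relations shows that [Y] commutes with [(s - t) *: D], hence with [D] unless
    [s = t]. *)
Lemma comm_mx_affine_inj (K : fieldType) (n : nat) (B D Y : 'M[K]_n) (s t : K) :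
  ~~ comm_mxb D Y ->
  comm_mx (B + s *: D) Y -> comm_mx (B + t *: D) Y -> s = t.
Proof.
move=> ncDY cs ct; apply/eqP; rewrite -subr_eq0; apply: contraNT ncDY => st0.
apply/comm_mxP; rewrite -[D](scalerK st0); apply: comm_mx_sym.
apply: comm_mx_scale.
have -> : (s - t) *: D = (B + s *: D) - (B + t *: D).
  by rewrite scalerBl opprD addrACA subrr add0r.
by apply: comm_mxB; apply: comm_mx_sym.
Qed.

(** * Slices under a linear substitution *)

Definition slice_comb {K : fieldType} {n m : nat} (T : tensor K n)
    (M : 'M[K]_(n, m)) (c : 'I_m) : 'M[K]_n :=
  \sum_(k < n) M k c *: slice T k.

Lemma slice_comb_mem (K : fieldType) (n m : nat) (T : tensor K n)
    (M : 'M[K]_(n, m)) (c : 'I_m) : slice_comb T M c \in slice_space T.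
Proof.
apply: rpred_sum => k _; apply/rpredZ/memv_span/tnthP.
by exists k; rewrite tnth_mktuple.
Qed.

Definition subst_tensor {K : fieldType} {n : nat} (T : tensor K n)
    (M : 'M[K]_n) : tensor K n :=
  fun a b c => \sum_(i < n) \sum_(j < n) \sum_(k < n)
    T i j k * (M i a * M j b * M k c).

Lemma subst_tensorP (K : fieldType) (n : nat) (f : {mpoly K[n]})
    (T : tensor K n) (M : 'M[K]_n) :
  tensor_of f T -> tensor_of (lin_subst f M) (subst_tensor T M).
Proof.
move=> [sT ->]; split=> [a b c|].
  split; rewrite /subst_tensor.
    rewrite exchange_big; apply: eq_bigr => i _; apply: eq_bigr => j _.
    by apply: eq_bigr => k _; rewrite (sT j i k).1 (mulrC (M j a)).
  apply: eq_bigr => i _; rewrite exchange_big; apply: eq_bigr => j _.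
  by apply: eq_bigr => k _; rewrite (sT i k j).2 mulrAC.
pose L i : {mpoly K[n]} := \sum_(a < n) M i a *: 'X_a.
have LE i j k : L i * L j * L k = \sum_(a < n) \sum_(b < n) \sum_(c < n)
    (M i a * M j b * M k c) *: ('X_a * 'X_b * 'X_c).
  rewrite /L -mulrA mulr_suml; apply: eq_bigr => a _.
  rewrite mulr_suml mulr_sumr; apply: eq_bigr => b _.
  rewrite !mulr_sumr; apply: eq_bigr => c _.
  by rewrite -!scalerAl -!scalerAr !scalerA !mulrA.
transitivity (\sum_(i < n) \sum_(j < n) \sum_(k < n)
    T i j k *: (L i * L j * L k)).
  rewrite /lin_subst /tensor_form raddf_sum; apply: eq_bigr => i _.
  rewrite raddf_sum; apply: eq_bigr => j _.
  rewrite raddf_sum; apply: eq_bigr => k _ /=.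
  by rewrite linearZ !rmorphM /= !comp_mpolyXU -!tnth_nth !tnth_mktuple.
pose G a b c i j k : {mpoly K[n]} :=
  T i j k *: ((M i a * M j b * M k c) *: ('X_a * 'X_b * 'X_c)).
(* Both triple sums are packed into sums over triples, so that one exchange swaps the tensor indices
   with the variable indices. *)
transitivity (\sum_(x : 'I_n * 'I_n * 'I_n) \sum_(y : 'I_n * 'I_n * 'I_n)
    G y.1.1 y.1.2 y.2 x.1.1 x.1.2 x.2).
  rewrite -(pair_bigA _ (fun x k => \sum_(y : 'I_n * 'I_n * 'I_n)
    G y.1.1 y.1.2 y.2 x.1 x.2 k)) /=.
  rewrite -(pair_bigA _ (fun i j => \sum_k \sum_(y : 'I_n * 'I_n * 'I_n)
    G y.1.1 y.1.2 y.2 i j k)) /=.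
  apply: eq_bigr => i _; apply: eq_bigr => j _; apply: eq_bigr => k _.
  rewrite -(pair_bigA _ (fun y c => G y.1 y.2 c i j k)) /=.
  rewrite -(pair_bigA _ (fun a b => \sum_c G a b c i j k)) /=.
  rewrite LE scaler_sumr; apply: eq_bigr => a _.
  by rewrite scaler_sumr; apply: eq_bigr => b _; rewrite scaler_sumr.
rewrite exchange_big /=.
rewrite -(pair_bigA _ (fun y c => \sum_(x : 'I_n * 'I_n * 'I_n)
  G y.1 y.2 c x.1.1 x.1.2 x.2)) /=.
rewrite -(pair_bigA _ (fun a b => \sum_c \sum_(x : 'I_n * 'I_n * 'I_n)
  G a b c x.1.1 x.1.2 x.2)) /=.
apply: eq_bigr => a _; apply: eq_bigr => b _; apply: eq_bigr => c _.
rewrite -(pair_bigA _ (fun x k => G a b c x.1 x.2 k)) /=.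
rewrite -(pair_bigA _ (fun i j => \sum_k G a b c i j k)) /=.
rewrite scaler_suml; apply: eq_bigr => i _.
rewrite scaler_suml; apply: eq_bigr => j _.
by rewrite scaler_suml; apply: eq_bigr => k _; rewrite /G scalerA.
Qed.

Lemma slice_subst_tensor (K : fieldType) (n : nat) (T : tensor K n)
    (M : 'M[K]_n) (c : 'I_n) :
  slice (subst_tensor T M) c = M^T *m slice_comb T M c *m M.
Proof.
apply/matrixP => a b; rewrite mxE /subst_tensor mxE exchange_big /=.
apply: eq_bigr => j _; rewrite mxE mulr_suml; apply: eq_bigr => i _.
rewrite /slice_comb summxE mulr_sumr mulr_suml; apply: eq_bigr => k _.
by rewrite !mxE mulrC (mulrAC (M i a)) [LHS]mulrAC !mulrA.
Qed.

(** Congruence by [M] conjugates [invmx A *m B] by [M], and conjugation preserves commutation.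
    Invertibility of the product yields that of [A] and [M]. *)
Lemma comm_mx_congr (K : fieldType) (n : nat) (M A B C : 'M[K]_n) :
  M^T *m A *m M \in unitmx ->
  comm_mx (invmx (M^T *m A *m M) *m (M^T *m B *m M))
          (invmx (M^T *m A *m M) *m (M^T *m C *m M)) ->
  A \in unitmx /\ comm_mx (invmx A *m B) (invmx A *m C).
Proof.
move=> u; move: (u); rewrite !unitmx_mul => /andP[/andP[_ uA] uM].
have conjE D : invmx (M^T *m A *m M) *m (M^T *m D *m M) =
    invmx M *m (invmx A *m D) *m M.
  apply: (can_inj (mulKmx u)); rewrite mulKVmx // !mulmxA (mulmxK uM).
  by rewrite (mulmxK uA).
rewrite !conjE /comm_mx => cBC; split=> //.
have := congr1 (fun X => M *m X *m invmx M) cBC.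
by rewrite /= !mulmxA (mulmxV uM) !mul1mx !(mulmxK uM).
Qed.

(** * Non-commuting pairs of slices *)

Lemma comm_slice_space (K : fieldType) (n : nat) (T : tensor K n)
    (A B D : 'M[K]_n) :
  (forall k, comm_mx D (A *m slice T k)) -> B \in slice_space T ->
  comm_mx D (A *m B).
Proof.
move=> cD /coord_span ->; rewrite mulmx_sumr; apply: comm_mx_sum => k _.
rewrite -tnth_nth tnth_mktuple -scalemxAr.
exact: comm_mx_scale.
Qed.

(** Commutation is linear in each argument, so if all pairs of slices commuted after multiplication
    by [invmx A], the whole space would. The boolean existential permits the argument by
    contradiction. *)
Lemma noncomm_slices (K : fieldType) (n : nat) (T : tensor K n) (A : 'M[K]_n) :
  ~ commutativity_property (slice_space T) ->
  A \in slice_space T -> A \in unitmx ->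
  [exists kl, ~~ comm_mxb (invmx A *m slice T kl.1) (invmx A *m slice T kl.2)].
Proof.
move=> nc AV uA; apply: contraT => /existsPn cT; case: nc.
exists A; split=> // _ _ /memv_imgP[B BV ->] /memv_imgP[C CV ->].
rewrite !lfunE /=; apply: comm_slice_space CV => l; apply: comm_mx_sym.
apply: comm_slice_space BV => k; apply: comm_mx_sym.
by apply/comm_mxP; have := cT (k, l); rewrite negbK.
Qed.

(** * Dependence of the combinations on a single entry *)

Lemma map_set_entry (A B : Type) (g : A -> B) (m n : nat) (M : 'M[A]_(m, n))
    (p : 'I_m * 'I_n) (s : A) :
  map_mx g (set_entry M p s) = set_entry (map_mx g M) p (g s).
Proof. by apply/matrixP => i j; rewrite !mxE; case: ifP. Qed.

Lemma slice_comb_set_neq (K : fieldType) (n m : nat) (T : tensor K n)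
    (M : 'M[K]_(n, m)) (k : 'I_n) (c c' : 'I_m) (s : K) :
  c' != c -> slice_comb T (set_entry M (k, c) s) c' = slice_comb T M c'.
Proof.
move=> c'c; apply: eq_bigr => i _.
by rewrite mxE xpair_eqE (negbTE c'c) andbF.
Qed.

Lemma slice_comb_set (K : fieldType) (n m : nat) (T : tensor K n)
    (M : 'M[K]_(n, m)) (k : 'I_n) (c : 'I_m) (s : K) :
  slice_comb T (set_entry M (k, c) s) c =
  (\sum_(i < n | i != k) M i c *: slice T i) + s *: slice T k.
Proof.
rewrite /slice_comb (bigD1 k) //= mxE eqxx addrC; congr (_ + _).
by apply: eq_bigr => i ik; rewrite mxE xpair_eqE (negbTE ik).
Qed.

(** * Probability as a count, and the union bound *)

Lemma prob_unif_mxE (R : realType) (K : fieldType) (S : {fset K}) (n : nat)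
    (E : pred 'M[K]_n) :
  prob_unif_mx R S E =
  #|[pred M : 'M[S]_n | E (map_mx val M)]|%:R / #|{: 'M[S]_n}|%:R.
Proof.
rewrite /prob_unif_mx sumr_const -[LHS]mulr_natl card_mx -cardfE natrX -exprVn.
rewrite exprM; congr (_ * _).
under eq_bigr => i _ do rewrite prodr_const card_ord.
by rewrite prodr_const card_ord.
Qed.

Lemma card_comm_slices (K : fieldType) (n : nat) (T : tensor K n)
    (S : {fset K}) (c1 c2 c3 : 'I_n) :
  c1 != c2 -> c1 != c3 -> c2 != c3 ->
  ~ commutativity_property (slice_space T) ->
  (#|[pred M : 'M[S]_n | let A := slice_comb T (map_mx val M) in
       (A c1 \in unitmx) &&
       comm_mxb (invmx (A c1) *m A c2) (invmx (A c1) *m A c3)]| * #|{: S}|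
   <= 2 * #|{: 'M[S]_n}|)%N.
Proof.
move=> c12 c13 c23 nc.
pose A (M : 'M[S]_n) := slice_comb T (map_mx val M).
pose I M := invmx (A M c1).
(* The choice reads only column [c1], so it survives changes in columns [c2] and [c3]. The default
   is never taken when [A M c1] is invertible. *)
pose wit M : 'I_n * 'I_n := odflt (c1, c1)
  [pick kl | ~~ comm_mxb (I M *m slice T kl.1) (I M *m slice T kl.2)].
have A_neq M k c c' s : c' != c -> A (set_entry M (k, c) s) c' = A M c'.
  by move=> c'c; rewrite /A map_set_entry slice_comb_set_neq.
have wit_eq M k c s : c1 != c -> wit (set_entry M (k, c) s) = wit M.
  by move=> c1c; rewrite /wit /I A_neq.
have witP M : A M c1 \in unitmx ->
    ~~ comm_mxb (I M *m slice T (wit M).1) (I M *m slice T (wit M).2).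
  move=> /(noncomm_slices _ _ _ _ nc (slice_comb_mem _ _ _ _ _ _)) /existsP[kl].
  by rewrite /wit; case: pickP => [//|/(_ kl) ->].
pose P1 : pred 'M[S]_n := fun M => (A M c1 \in unitmx) &&
  comm_mxb (I M *m A M c2) (I M *m slice T (wit M).2).
pose P2 : pred 'M[S]_n := fun M => [&& A M c1 \in unitmx,
  ~~ comm_mxb (I M *m A M c2) (I M *m slice T (wit M).2) &
  comm_mxb (I M *m A M c2) (I M *m A M c3)].
have P1le : (#|P1| * #|{: S}| <= #|{: 'M[S]_n}|)%N.
  (* This entry moves [I M *m A M c2] along the first matrix of the witness pair, which does not
     commute with the second. *)
  apply: (card_determined_entry _ _ _ _ (fun M => ((wit M).1, c2))).
    by move=> M s; rewrite wit_eq.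
  move=> M s t; rewrite /P1 !wit_eq // /I !(A_neq _ _ _ c1) // => /andP[uA cs] /andP[_ ct].
  apply/val_inj; move: cs ct; rewrite /A !map_set_entry !slice_comb_set !mulmxDr.
  rewrite -!scalemxAr => /comm_mxP cs /comm_mxP ct.
  exact: comm_mx_affine_inj (witP _ uA) cs ct.
have P2le : (#|P2| * #|{: S}| <= #|{: 'M[S]_n}|)%N.
  (* This entry moves [I M *m A M c3] along the second matrix of the pair, which does not commute
     with the fixed matrix [I M *m A M c2]. *)
  apply: (card_determined_entry _ _ _ _ (fun M => ((wit M).2, c3))).
    by move=> M s; rewrite wit_eq.
  move=> M s t; rewrite /P2 !wit_eq // /I !(A_neq _ _ _ c1, A_neq _ _ _ c2) //.
  move=> /and3P[uA ncA cs] /and3P[_ _ ct].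
  apply/val_inj; move: cs ct; rewrite /A !map_set_entry !slice_comb_set !mulmxDr.
  rewrite -!scalemxAr => /comm_mxP/comm_mx_sym cs /comm_mxP/comm_mx_sym ct.
  apply: comm_mx_affine_inj cs ct; apply: contra ncA => /comm_mxP.
  by move=> /comm_mx_sym/comm_mxP.
rewrite mul2n -addnn; apply: leq_trans (leq_add P1le P2le).
rewrite -mulnDl leq_mul2r; apply/orP; right.
(* Union bound: it remains to cover the event by [P1] and [P2]. *)
rewrite -cardUI; apply: leq_trans (leq_addr _ _).
apply/subset_leq_card/subsetP => M; rewrite !inE => /andP[uA cA].
have [cW|ncW] := boolP (comm_mxb (I M *m A M c2) (I M *m slice T (wit M).2)).
  by apply/orP; left; apply/andP.
by apply/orP; right; apply/and3P.
Qed.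

Local Open Scope fset_scope.

Theorem theorem2p14 (R : realType) (K : fieldType)
  (hK : K = (R : fieldType) \/ K = (R[i] : fieldType))
  (n : nat) (f : {mpoly K[n]}) (f_homog : f \is 3.-homog)
  (Tf : tensor K n) (hTf : tensor_of f Tf)
  (f_nonsing : nonsingular_space (slice_space Tf))
  (f_noncomm : ~ commutativity_property (slice_space Tf))
  (S : {fset K}) (S_neq0 : S != fset0)
  (T : 'M[K]_n -> tensor K n)
  (hT : forall M : 'M[K]_n, tensor_of (lin_subst f M) (T M))
  (k1 k2 k3 : 'I_n)
  (hk1 : k1 = 0%N :> nat) (hk2 : k2 = 1%N :> nat) (hk3 : k3 = 2%N :> nat) :
  prob_unif_mx R S (fun M : 'M[K]_n =>
      let T1 := slice (T M) k1 in
      let T2 := slice (T M) k2 in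
      let T3 := slice (T M) k3 in
      (T1 \in unitmx) && comm_mxb (invmx T1 *m T2) (invmx T1 *m T3))
    <= 2%:R / (#|` S|)%:R.
Proof.
(* Since 6 is nonzero, a cubic form has only one symmetric tensor, so the given [T M] agrees with
   [subst_tensor Tf M]. *)
have K6 : 6%:R != 0 :> K by case: hK => -> ; rewrite pnatr_eq0.
have sliceE M c : slice (T M) c = M^T *m slice_comb Tf M c *m M.
  rewrite -slice_subst_tensor; apply/matrixP => i j; rewrite !mxE.
  exact: tensor_of_unique K6 (hT M) (subst_tensorP _ _ _ _ _ hTf) i j c.
have S0 : (0 < #|{: S}|)%N by rewrite -cardfE cardfs_gt0.
have M0 : (0 < #|{: 'M[S]_n}|)%N by rewrite card_mx expn_gt0 S0.
(* Both denominators are positive because [S] is nonempty; clearing them leaves an inequality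
   between natural numbers. *)
rewrite prob_unif_mxE cardfE ler_pdivrMr ?ltr0n // mulrAC ler_pdivlMr ?ltr0n //.
rewrite -!natrM ler_nat.
have k12 : k1 != k2 by rewrite -val_eqE /= hk1 hk2.
have k13 : k1 != k3 by rewrite -val_eqE /= hk1 hk3.
have k23 : k2 != k3 by rewrite -val_eqE /= hk2 hk3.
apply: leq_trans (card_comm_slices _ _ _ S _ _ _ k12 k13 k23 f_noncomm).
rewrite leq_mul2r; apply/orP; right.
apply/subset_leq_card/subsetP => M; rewrite !inE /= !sliceE.
move=> /andP[u /comm_mxP c].
by have [-> /comm_mxP] := comm_mx_congr _ _ _ _ _ _ u c.
Qed.
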